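(* Let $X$ be a complex reflexive Banach space, $x\in X$ a unit vector, and $x^*\in X^*$ a functional that exposes $x$. If $T=\{e^{tA}:t\ge 0\}$ is a $(C_0)$ contraction semigroup with generator $A$ such that \[\lim_{t\to\infty}|\langle T(t)x,x^*\rangle|=1,\] then $x$ is in the domain of $A$ and $Ax=i\lambda x$ for some real number $\lambda$.
   Context: A functional $x^*\in X^*$ exposes the unit vector $x$ if $1=\|x^*\|=\langle x,x^*\rangle$ and $\Re\langle y,x^*\rangle<1$ for every unit vector $y\neq x$. *)

(* Defs.v *)
From HB Require Import structures.
From mathcomp Require Import all_boot all_order all_algebra.
From mathcomp Require Import all_classical all_reals all_analysis.
From mathcomp Require Import complex.
Set Implicit Arguments. Unset Strict Implicit. Unset Printing Implicit Defensive.
Import Order.TTheory GRing.Theory Num.Theory.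
Import numFieldTopology.Exports numFieldNormedType.Exports.
Local Open Scope ring_scope.
Local Open Scope complex_scope.
Local Open Scope classical_set_scope.

HB.instance Definition _ (R : realType) := PseudoPointedMetric.copy R[i] (R[i])^o.
HB.instance Definition _ (R : realType) := NormedModule.copy R[i] (R[i])^o.

Section Defs.
Variables (R : realType) (V : normedModType R[i]).

Definition dual_space : set (V -> R[i]) :=
  [set f | linear f /\ continuous f].

(* Dual (operator) norm  ||f|| = sup { |f y| : ||y|| <= 1 }  (a real number;
   norms in R[i] are real, complex.Re extracts them as elements of R). *)
Definition dual_norm (f : V -> R[i]) : R :=
  sup [set complex.Re `|f y| | y in [set y : V | `|y| <= 1]].

(* V is reflexive: the canonical embedding J : X -> X^** , (J x)(f) = f x,
   is onto X^** (the bounded, hence continuous, C-linear functionals on X^*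
   with its dual norm). *)
Definition reflexive_space : Prop :=
  forall Phi : (V -> R[i]) -> R[i],
    (forall (a : R[i]) (f g : V -> R[i]), dual_space f -> dual_space g ->
        Phi (fun y => a * f y + g y) = a * Phi f + Phi g) ->
    (exists M : R, forall f, dual_space f -> `|Phi f| <= (M * dual_norm f)%:C) ->
    exists x : V, forall f, dual_space f -> Phi f = f x.

Definition exposes (xs : V -> R[i]) (x : V) : Prop :=
  [/\ dual_space xs, dual_norm xs = 1, xs x = 1 &
      forall y : V, `|y| = 1 -> y <> x -> 'Re (xs y) < 1].

Definition C0_contraction_semigroup (T : R -> V -> V) : Prop :=
  [/\ forall t, 0 <= t -> linear (T t) /\ continuous (T t),
      forall y, T 0 y = y,
      forall s t y, 0 <= s -> 0 <= t -> T (s + t) y = T s (T t y),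
      forall y, T t y @[t --> 0^'+] --> y &
      forall t y, 0 <= t -> `|T t y| <= `|y| ].

(* Generator A of T:  x \in D(A) with A x = z  iff
   (T t x - x)/t --> z as t --> 0+. *)
Definition generator_value (T : R -> V -> V) (x z : V) : Prop :=
  (t%:C)^-1 *: (T t x - x) @[t --> 0^'+] --> z.

End Defs.

(* Main.v *)
(* Multiply T(t)x by a phase c(t) so that <c(t)T(t)x, x^*> = |<T(t)x, x^*>|,
   which tends to 1. By reflexivity c(t)T(t)x has a weak limit along an
   ultrafilter at infinity; it lies in the unit ball and x^* equals 1 there, so
   it is the exposed point x. Testing against x^* o T(s) then gives
   |<T(s)x, x^*>| = lim |<T(s+t)x, x^*>| = 1 for every s >= 0, and exposedness
   again yields T(s)x = chi(s)x with chi a unitary character of [0, oo) that is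
   continuous at 0. Hence chi(s) = exp(i lambda s): after dividing by the
   exponential that agrees with chi at a small c > 0, one gets a c-periodic
   character with values of real part > 1/2, and such a character is trivial
   since iterated squaring drives any other unit number out of that region.

   That the weak limit stays in the unit ball needs a norming functional; it is
   obtained from a minimal sublinear functional below the norm. *)
Require Import Defs.
From HB Require Import structures.
From mathcomp Require Import all_boot all_order all_algebra.
From mathcomp Require Import all_classical all_reals all_analysis.
From mathcomp Require Import complex.
From mathcomp Require Import ring lra.
Import Order.TTheory GRing.Theory Num.Theory.
Import numFieldTopology.Exports numFieldNormedType.Exports.
Local Open Scope ring_scope.
Local Open Scope complex_scope.
Local Open Scope classical_set_scope.

(** * Hahn-Banach: norming functionals *)

Definition rnorm {R : realType} {V : normedModType R[i]} (z : V) : R :=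
  complex.Re `|z|.

(** Only positive real scalars are tested, since Hahn-Banach is run over the reals first. The
    inequality for [a] and [a^-1] together gives equality, so one direction is enough to check for
    infima. *)
Definition sublinear {R : realType} {V : normedModType R[i]} (p : V -> R) :=
  (forall z w, p (z + w) <= p z + p w) /\
  (forall (a : R) z, 0 < a -> p (a%:C *: z) <= a * p z).

Definition norm_dominated {R : realType} {V : normedModType R[i]}
  (p : V -> R) := sublinear p /\ forall z, p z <= rnorm z.

Lemma rnormE (R : realType) (V : normedModType R[i]) (z : V) :
  `|z| = (rnorm z)%:C.
Proof. by rewrite /rnorm RRe_real // normr_real. Qed.

Lemma sublinear_rnorm (R : realType) (V : normedModType R[i]) :
  sublinear (@rnorm R V).
Proof.
split=> [z w|a z a0].
  by rewrite -lecR rmorphD /= -!rnormE ler_normD.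
rewrite -lecR rmorphM /= -!rnormE normrZ.
by rewrite ger0_norm // lecR ltW.
Qed.

Lemma rnormN (R : realType) (V : normedModType R[i]) (z : V) :
  rnorm (- z) = rnorm z.
Proof. by rewrite /rnorm normrN. Qed.

Lemma sublinearZ (R : realType) (V : normedModType R[i]) (p : V -> R)
  (a : R) (z : V) : sublinear p -> 0 < a -> p (a%:C *: z) = a * p z.
Proof.
move=> [_ pZ] a0; apply/eqP; rewrite eq_le pZ //= -ler_pdivlMl //.
apply: le_trans (pZ _ _ _); last by rewrite invr_gt0.
by rewrite scalerA -rmorphM /= mulVf ?gt_eqF // scale1r.
Qed.

Lemma norm_dominated0 (R : realType) (V : normedModType R[i]) (p : V -> R) :
  norm_dominated p -> p 0 = 0.
Proof.
move=> [[pD _] pN]; have := pD 0 0; have := pN 0.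
by rewrite /rnorm normr0 addr0 /=; lra.
Qed.

Lemma norm_dominated_ge (R : realType) (V : normedModType R[i])
  (p : V -> R) (z w : V) : norm_dominated p -> - rnorm z <= p (w + z) - p w.
Proof.
move=> pd; case: (pd) => [[pD _] pN].
have := pD (w + z) (- z); have := pN (- z); rewrite rnormN addrK; lra.
Qed.

(** Serves both chains of functionals and the rays of [ray_shift]: subadditivity passes to the
    infimum as soon as some index [k] does at least as well as any given pair. The lower bound keeps
    [inf] away from its default value on sets unbounded below. *)
Lemma sublinear_inf (R : realType) (V : normedModType R[i]) (I : Type) (i0 : I)
    (G : I -> V -> R) (p := fun z => inf (range (G^~ z))) :
  (forall i z, - rnorm z <= G i z) ->
  (forall i j z w, exists k, G k (z + w) <= G i z + G j w) ->
  (forall i (a : R) z, 0 < a -> exists k, G k (a%:C *: z) <= a * G i z) ->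
  sublinear p /\ forall i z, p z <= G i z.
Proof.
move=> GN GD GZ.
have pG i z : p z <= G i z.
  apply: ge_inf; last by exists i.
  by exists (- rnorm z) => _ [j _ <-].
have pinf z (m : R) : (forall i, m <= G i z) -> m <= p z.
  move=> mG; apply: lb_le_inf; first by exists (G i0 z); exists i0.
  by move=> _ [j _ <-].
split=> //; split=> [z w|a z a0].
  rewrite -lerBlDr; apply: (pinf) => i; rewrite lerBlDl -lerBlDr; apply: pinf => j.
  have [k Gk] := GD i j z w.
  by rewrite lerBlDl; exact: le_trans (pG k _) Gk.
rewrite -ler_pdivrMl //; apply: pinf => i; rewrite ler_pdivrMl //.
by have [k Gk] := GZ i a z a0; exact: le_trans (pG k _) Gk.
Qed.

(** Zorn's lemma: the pointwise infimum of a nonempty chain is again norm-dominated, with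
    [norm_dominated_ge] bounding it from below. *)
Lemma minimal_norm_dominated (R : realType) (V : normedModType R[i])
    (p0 : V -> R) : norm_dominated p0 ->
  exists p, [/\ norm_dominated p, forall z, p z <= p0 z &
    forall q, norm_dominated q -> (forall z, q z <= p z) -> q = p].
Proof.
move=> p0d.
pose S := {p : V -> R | norm_dominated p /\ forall z, p z <= p0 z}.
pose s0 : S := exist _ p0 (conj p0d (fun z => lexx (p0 z))).
(* The order is reversed, so that maximal elements are minimal functionals. *)
pose rel_ (p q : S) := `[< forall z, sval q z <= sval p z >].
have [] := @ZL_preorder S s0 rel_.
- by move=> s; apply/asboolP.
- move=> r s t /asboolP rs /asboolP st; apply/asboolP => z.
  exact: le_trans (st z) (rs z).
- move=> A Atot; have [[s1 As1]|A0] := pselect (A !=set0); last first.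
    by exists s0 => s As; exfalso; apply: A0; exists s.
  pose G (i : {s : S | A s}) := sval (sval i).
  have Gsub i : sublinear (G i) by exact: (svalP (sval i)).1.1.
  have [|||pS pG] := @sublinear_inf R V _ (exist _ s1 As1) G.
  + move=> [[q [qd qp0]] Aq] z /=.
    by have := norm_dominated_ge _ _ _ z 0 qd; rewrite norm_dominated0 // add0r subr0.
  + move=> i j z w.
    have [/asboolP ij|/asboolP ij] := Atot _ _ (svalP i) (svalP j).
      exists j; have [D _] := Gsub j.
      by apply: le_trans (D _ _) _; rewrite lerD2r; exact: ij.
    exists i; have [D _] := Gsub i.
    by apply: le_trans (D _ _) _; rewrite lerD2l; exact: ij.
  + by move=> i a z a0; exists i; have [_ Z] := Gsub i; exact: Z.
  set p := fun z : V => _ in pS pG.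
  have pp0 z : p z <= p0 z.
    apply: le_trans (pG (exist _ s1 As1) z) _; rewrite /G /=.
    by case: {As1 pG} s1 => q [].
  have pd : norm_dominated p.
    by split=> // z; exact: le_trans (pp0 z) (p0d.2 z).
  exists (exist _ p (conj pd pp0)) => s As; apply/asboolP => z /=.
  exact: (pG (exist _ s As)).
- move=> [p [pd pp0]] pmax; exists p; split=> // q qd qp.
  have qp0 z : q z <= p0 z by exact: le_trans (qp z) (pp0 z).
  have /asboolP /= := pmax (exist _ q (conj qd qp0)) (asboolT qp).
  by move=> pq; apply/funext => z; apply/eqP; rewrite eq_le qp pq.
Qed.

(* [q z] is the infimum of [p (z + t v) - t p v] over [t >= 0]. When [p] is
   minimal, [q = p], and the last conjunct makes [p] additive. *)
Lemma ray_shift (R : realType) (V : normedModType R[i]) (p : V -> R) (v : V) :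
  norm_dominated p ->
  exists q, [/\ norm_dominated q, forall z, q z <= p z &
    forall z, q z <= p (z + v) - p v].
Proof.
move=> pd; case: (pd) => [[pD pZ] pN].
(* Using [|t|] lets all of [R] index the half-line, without a subtype. *)
pose G (t : R) z := p (z + `|t|%:C *: v) - `|t| * p v.
have [|||qS qG] := @sublinear_inf R V R 0 G.
- move=> t z; rewrite /G [z + _]addrC; have := norm_dominated_ge _ _ _ z (`|t|%:C *: v) pd.
  move/le_trans; apply; rewrite lerD2l lerN2.
  have [->|t0] := eqVneq t 0; first by rewrite normr0 scale0r mul0r norm_dominated0.
  by rewrite (sublinearZ _ _ p) // normr_gt0.
- move=> s t z w; exists (`|s| + `|t|); rewrite /G.
  rewrite [`| _ + _ |]ger0_norm ?addr_ge0 // rmorphD /= scalerDl addrACA.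
  have := pD (z + `|s|%:C *: v) (w + `|t|%:C *: v); lra.
- move=> t a z a0; exists (a * t); rewrite /G normrM (gtr0_norm a0).
  rewrite rmorphM /= -scalerA -scalerDr mulrBr mulrA lerD2r.
  exact: pZ.
- exists (fun z => inf (range (G^~ z))).
  have qp z : inf (range (G^~ z)) <= p z.
    by apply: le_trans (qG 0 z) _; rewrite /G normr0 scale0r addr0 mul0r subr0.
  split=> //; first by split=> // z; exact: le_trans (qp z) (pN z).
  by move=> z; apply: le_trans (qG 1 z) _; rewrite /G normr1 scale1r mul1r.
Qed.

(** Minimizing below the shift [q] of the norm along [y], rather than below the norm itself, fixes
    the value at [y]: [q (- y) <= - rnorm y] passes to [p], and additivity turns it into
    [rnorm y <= p y]. *)
Lemma real_norming_functional (R : realType) (V : normedModType R[i]) (y : V) :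
  exists p : V -> R, [/\ forall z w, p (z + w) = p z + p w,
    forall (a : R) z, p (a%:C *: z) = a * p z,
    forall z, p z <= rnorm z & p y = rnorm y].
Proof.
have Nd : norm_dominated (@rnorm R V) by split=> //; exact: sublinear_rnorm.
have [q [qd _ qy]] := ray_shift _ _ _ y Nd.
have [p [pd pq pmin]] := minimal_norm_dominated _ _ _ qd.
have pD z w : p (z + w) = p z + p w.
  (* Minimality gives [r = p], hence superadditivity. *)
  have [r [rd rp rw]] := ray_shift _ _ _ w pd.
  apply/eqP; rewrite eq_le; case: (pd) => [[-> _] _] /=.
  have rpE := pmin _ rd rp.
  by have := rw z; rewrite rpE lerBrDr.
have p0 := norm_dominated0 _ _ _ pd.
have pNE z : p (- z) = - p z.
  by apply/eqP; rewrite -addr_eq0 -pD addNr p0.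
case: (pd) => [[_ pZ] pN].
have pZpos (a : R) z : 0 < a -> p (a%:C *: z) = a * p z by apply: sublinearZ; case: pd.
exists p; split=> //.
  move=> a z; have [a0|a0|<-] := ltgtP 0 a.
  - exact: pZpos.
  - have := pZpos (- a) z; rewrite oppr_gt0 => /(_ a0).
    by rewrite rmorphN /= scaleNr pNE mulNr => /oppr_inj.
  - by rewrite scale0r p0 mul0r.
apply/eqP; rewrite eq_le pN /=.
have := le_trans (pq (- y)) (qy (- y)).
by rewrite pNE addNr /rnorm normr0 /= sub0r lerN2.
Qed.

(** The usual complexification [p z - i p (i z)] of a real functional. *)
Lemma norming_functional (R : realType) (V : normedModType R[i]) (y : V) :
  exists f : V -> R[i], [/\ linear f, forall z, `|f z| <= `|z| & `|f y| = `|y|].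
Proof.
have [p [pD pZ pN py]] := real_norming_functional _ _ y.
pose f z : R[i] := p z +i* - p ('i *: z).
have fD z w : f (z + w) = f z + f w.
  by rewrite /f scalerDr !pD; apply/eqP; rewrite eq_complex /= opprD !eqxx.
have fZ (a : R[i]) z : f (a *: z) = a * f z.
  case: a => a b; have -> : (a +i* b) *: z = a%:C *: z + b%:C *: ('i *: z).
    rewrite scalerA -scalerDl; congr (_ *: _).
    by apply/eqP; rewrite eq_complex /=; apply/andP; split; apply/eqP; ring.
  have pi2 : p ('i *: ('i *: z)) = - p z.
    by rewrite scalerA -expr2 sqr_i -(rmorphN1 (real_complex R)) pZ mulN1r.
  rewrite fD /f ![_ *: (_%:C *: _)]scalerA ![_ * _%:C]mulrC -!scalerA !pZ pi2.
  by apply/eqP; rewrite eq_complex /=; apply/andP; split; apply/eqP; ring.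
have fN z : `|f z| <= `|z|.
  have [->|f0] := eqVneq (f z) 0; first by rewrite normr0.
  (* Rotating [z] by [u] makes the value of [f] real, hence equal to that of [p], which the norm
     dominates. *)
  pose u := `|f z| / f z.
  have u1 : `|u| = 1 by rewrite normf_div normr_id divff // normr_eq0.
  have fu : f (u *: z) = `|f z| by rewrite fZ /u divfK.
  have pu : (p (u *: z))%:C = `|f z| by rewrite rnormE /rnorm -fu.
  rewrite -pu (rnormE _ _ z) lecR; apply: le_trans (pN _) _.
  by rewrite /rnorm normrZ u1 mul1r.
exists f; split=> //; first by move=> a z w; rewrite fD fZ.
apply/eqP; rewrite eq_le fN /=; apply: le_trans (normc_ge_Re _).
by rewrite /= py rnormE lecR ler_norm.
Qed.

(** * Weak cluster points of bounded families *)

Lemma cvg_complex (R : realType) (I : Type) (F : set_system I) (FF : Filter F)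
    (u : I -> R[i]) (l : R[i]) :
  complex.Re (u i) @[i --> F] --> complex.Re l ->
  complex.Im (u i) @[i --> F] --> complex.Im l ->
  u i @[i --> F] --> l.
Proof.
move=> /cvgrPdist_lt ul /cvgrPdist_lt vl; apply/cvgrPdist_lt => e.
(* A positive element of [R[i]] has zero imaginary part, so the tolerance is real and splits in
   halves. *)
case: e => e e' e0; have /eqP e'0 : e' == 0 by move: e0; rewrite ltcE => /andP[].
rewrite {}e'0 in e0 *; have {}e0 : 0 < e by move: e0; rewrite ltcE => /andP[].
have nC (a : R) : `|a%:C| = `|a|%:C by rewrite normc_def /= expr0n addr0 sqrtr_sqr.
have e20 : 0 < e / 2 by rewrite divr_gt0.
apply: filterS2 (ul _ e20) (vl _ e20) => i uli vli.
have -> : l - u i = (complex.Re l - complex.Re (u i))%:C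
                  + 'i * (complex.Im l - complex.Im (u i))%:C.
  by rewrite [LHS]complexE; case: (l) => ? ?; case: (u i).
apply: le_lt_trans (ler_normD _ _) _.
rewrite normrM.
have -> : `|'i : R[i]| = 1 by rewrite normc_def /= expr0n expr1n add0r sqrtr1.
by rewrite mul1r !nC -rmorphD /= ltcR (splitr e) ltrD.
Qed.

(** Compactness of [[-M, M]] gives a cluster point, and an ultrafilter converges to each of its
    cluster points. *)
Lemma ultra_cvg_bounded (R : realType) (I : Type) (U : set_system I)
    (v : I -> R) (M : R) : UltraFilter U ->
  (\forall i \near U, `|v i| <= M) -> cvg (v i @[i --> U]).
Proof.
move=> UU vM.
have [|l [_ lcl]] := @segment_compact R (- M) M (v @ U) _.
  by apply: filterS vM => i; rewrite /= in_itv /= ler_norml.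
apply/cvg_ex; exists l => A Al /=.
have [//|UnA] := in_ultra_setVsetC (v @^-1` A) UU.
have [|] := lcl (~` A) A _ Al; first exact: UnA.
by move=> y [].
Qed.

Lemma ultra_cvg_bounded_complex (R : realType) (I : Type) (U : set_system I)
    (u : I -> R[i]) (M : R) : UltraFilter U ->
  (\forall i \near U, `|u i| <= M%:C) -> cvg (u i @[i --> U]).
Proof.
move=> UU uM.
have /cvg_ex[a ua] : cvg (complex.Re (u i) @[i --> U]).
  apply: (@ultra_cvg_bounded _ _ _ _ M) => //; apply: filterS uM => i /=.
  rewrite normc_def !lecR; apply: le_trans; rewrite -sqrtr_sqr.
  by rewrite ler_wsqrtr // lerDl sqr_ge0.
have /cvg_ex[b ub] : cvg (complex.Im (u i) @[i --> U]).
  apply: (@ultra_cvg_bounded _ _ _ _ M) => //; apply: filterS uM => i /=.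
  rewrite normc_def !lecR; apply: le_trans; rewrite -sqrtr_sqr.
  by rewrite ler_wsqrtr // lerDr sqr_ge0.
by apply/cvg_ex; exists (a +i* b); exact: cvg_complex.
Qed.

Lemma dual_space0 (R : realType) (V : normedModType R[i]) (f : V -> R[i]) :
  dual_space f -> f 0 = 0.
Proof.
by move=> [fl _]; have := fl (-1) 0 0; rewrite scaler0 addr0 scaleN1r addNr.
Qed.

Lemma dual_spaceZ (R : realType) (V : normedModType R[i]) (f : V -> R[i])
  (a : R[i]) (z : V) : dual_space f -> f (a *: z) = a * f z.
Proof.
by move=> df; rewrite -[_ *: z]addr0 (proj1 df) dual_space0 // addr0.
Qed.

(** Continuity of [f] bounds the set under the [sup], which makes [dual_norm f] a true upper
    bound. *)
Lemma dual_norm_ub (R : realType) (V : normedModType R[i]) (f : V -> R[i])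
  (z : V) : dual_space f -> `|z| <= 1 -> `|f z| <= (dual_norm f)%:C.
Proof.
move=> [fl fc] z1.
pose g : {linear V -> R[i]} := HB.pack f (GRing.isLinear.Build _ _ _ _ f fl).
have /linear_boundedP : bounded_near g (nbhs (0 : V)).
  exact/linear_bounded_continuous.
move=> /pinfty_ex_gt0[[r r'] r0 /= fr].
rewrite -(RRe_real (normr_real (f z))) lecR; apply: ub_le_sup; last by exists z.
exists r => _ [y /= y1 <-].
have : `|f y| <= (r +i* r') by apply: le_trans (fr y) _; rewrite ler_piMr // ltW.
by rewrite lecE => /andP[].
Qed.

Lemma dual_norm_le (R : realType) (V : normedModType R[i]) (f : V -> R[i])
  (z : V) : dual_space f -> `|f z| <= (dual_norm f)%:C * `|z|.
Proof.
move=> df; have [->|z0] := eqVneq z 0.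
  by rewrite dual_space0 // !normr0 mulr0.
have nz : `|z| != 0 by rewrite normr_eq0.
have -> : f z = `|z| * f (`|z|^-1 *: z) by rewrite dual_spaceZ // mulVKf.
rewrite normrM normr_id mulrC ler_wpM2r // dual_norm_ub //.
by rewrite normrZ normfV normr_id mulVf.
Qed.

Lemma cvg_norm_le (R : realType) (V : normedModType R[i]) (I : Type)
    (F : set_system I) (u : I -> V) (l : V) (M : R) : ProperFilter F ->
  u i @[i --> F] --> l -> (\forall i \near F, `|u i| <= M%:C) -> `|l| <= M%:C.
Proof.
move=> FF ul uM; rewrite real_leNgt ?normr_real //; last first.
  by apply/complex_realP; exists M.
apply/negP => Ml.
have [i [Mi]] := filter_ex (filterI (cvgr_norm_gt _ ul _ Ml) uM).
by move=> /(lt_le_trans Mi); rewrite ltxx.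
Qed.

Lemma cvg_scaleD (R : realType) (I : Type) (F : set_system I) (u v : I -> R[i])
    (a l m : R[i]) : Filter F ->
  u i @[i --> F] --> l -> v i @[i --> F] --> m ->
  (a * u i + v i) @[i --> F] --> a * l + m.
Proof.
move=> FF ul vm.
have aul := @cvgZl_tmp R[i] R[i] I F FF a u l ul.
exact: (@cvgD R[i] R[i] I F FF _ _ _ _ aul vm).
Qed.

(** Along one ultrafilter the limits exist for all [f] at once. They form a linear functional on the
    dual with bound 1, which reflexivity represents by [z]. *)
Lemma weak_cluster (R : realType) (X : normedModType R[i]) (I : Type)
    (F : set_system I) (y : I -> X) : ProperFilter F -> reflexive_space X ->
  (\forall i \near F, `|y i| <= 1) ->
  exists (z : X) (U : set_system I), [/\ UltraFilter U, F `<=` U, `|z| <= 1 &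
    forall f, dual_space f -> f (y i) @[i --> U] --> f z].
Proof.
move=> FF Xrefl y1; have [U [UU FU]] := ultraFilterLemma FF.
have ydual f : dual_space f ->
    \forall i \near U, `|f (y i)| <= (dual_norm f)%:C.
  move=> df; apply: FU; apply: filterS y1 => i yi.
  exact: dual_norm_ub.
have ycvg f : dual_space f -> cvg (f (y i) @[i --> U]).
  by move=> df; apply: ultra_cvg_bounded_complex (ydual f df).
have [||z fz] := Xrefl (fun f => lim (f (y i) @[i --> U])).
- move=> a f g df dg; apply: (@cvg_lim R[i]); first exact: norm_hausdorff.
  exact: (cvg_scaleD _ _ _ _ _ a _ _ _ (ycvg f df) (ycvg g dg)).
- exists 1 => f df; rewrite mul1r.
  exact: cvg_norm_le (ycvg f df) (ydual f df).
exists z, U; split; [exact: UU|exact: FU| |]; last first.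
  by move=> f df; rewrite -(fz f df); exact: (ycvg f df).
(* For [f] norming [z], the norm of [z] is the modulus of a limit of values [f (y i)] of modulus at
   most 1. *)
have [f [fl fN fz1]] := norming_functional _ _ z.
have df : dual_space f.
  split=> // a; apply/cvgrPdist_lt => e e0.
  near=> b; have -> : f a - f b = f (a - b).
    by have := fl (-1) b a; rewrite !scaleN1r ![- _ + _]addrC => ->.
  apply: le_lt_trans (fN _) _; near: b.
  by move: e e0; apply/cvgrPdist_lt.
rewrite -fz1 -(fz f df).
apply: (@cvg_norm_le R R[i] _ _ _ _ 1 _ (ycvg f df)).
by apply: FU; apply: filterS y1 => i; apply: le_trans.
Unshelve. all: by end_near. Qed.

(** * Exposed points *)

(** Dual norm 1 and [xs z = 1] force [z] onto the unit sphere, where exposedness leaves only [x]. *)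
Lemma exposes_unique (R : realType) (X : normedModType R[i]) (xs : X -> R[i])
    (x z : X) : exposes xs x -> `|z| <= 1 -> xs z = 1 -> z = x.
Proof.
move=> [dxs n1 _ xsR] z1 xsz; apply: contrapT => zx.
have nz : `|z| = 1.
  apply/eqP; rewrite eq_le z1 /=.
  by have := dual_norm_le _ _ _ z dxs; rewrite xsz n1 normr1 mul1r.
by have := xsR z nz zx; rewrite xsz -complexRe ltxx.
Qed.

Lemma exposes_phase (R : realType) (X : normedModType R[i]) (xs : X -> R[i])
    (x z : X) : exposes xs x -> `|z| <= 1 -> `|xs z| = 1 -> z = xs z *: x.
Proof.
move=> xsx z1 xsz; have dxs : dual_space xs by case: xsx.
have xsz0 : xs z != 0 by rewrite -normr_eq0 xsz oner_neq0.
rewrite -(exposes_unique _ _ _ _ ((xs z)^-1 *: z) xsx).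
- by rewrite scalerA mulfV // scale1r.
- by rewrite normrZ normfV xsz invr1 mul1r.
- by rewrite dual_spaceZ // mulVf.
Qed.

Lemma cvg_addl_pinfty (R : realType) (s : R) : (s + t) @[t --> +oo] --> +oo.
Proof.
move=> A [M [Mr MA]]; exists (M - s); split; first by rewrite num_real.
by move=> t tM; apply: MA; rewrite addrC -ltrBlDr.
Qed.

Lemma norm_orbit_functional (R : realType) (X : normedModType R[i])
    (x : X) (xs : X -> R[i]) (T : R -> X -> X) (s : R) :
  reflexive_space X -> `|x| = 1 -> exposes xs x ->
  C0_contraction_semigroup T ->
  `|xs (T t x)| @[t --> +oo] --> (1 : R[i]) -> 0 <= s -> `|xs (T s x)| = 1.
Proof.
move=> Xrefl x1 xsx [Tlc T0 TD _ Tle] Tx s0.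
have dxs : dual_space xs by case: xsx.
(* Where [xs (T t x)] vanishes, division by zero gives [c t = 0]; thus [c t] is a phase only for
   large [t]. *)
pose c t := `|xs (T t x)| / xs (T t x).
pose y t := c t *: T t x.
have c1 : \forall t \near +oo, `|c t| = 1.
  have : \forall t \near +oo, (0 : R[i]) < `| `|xs (T t x)| |.
    by apply: (cvgr_norm_gt _ Tx); rewrite normr1.
  apply: filterS => t; rewrite normr_id normr_gt0 => h.
  by rewrite normf_div normr_id divff // normr_eq0.
have y1 : \forall t \near +oo, `|y t| <= 1.
  near=> t; rewrite normrZ (near c1 t) // mul1r -x1; apply: Tle.
  by near: t; apply: nbhs_pinfty_ge.
have [z [U [UU FU z1 yz]]] := weak_cluster _ _ _ _ _ _ Xrefl y1.
have xsy t : xs (y t) = `|xs (T t x)|.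
  rewrite /y dual_spaceZ // /c; have [->|h] := eqVneq (xs (T t x)) 0.
    by rewrite mulr0 normr0.
  by rewrite divfK.
have zx : z = x.
  apply: exposes_unique xsx z1 _.
  apply: (@cvg_unique R[i] (@norm_hausdorff _ _) _ _ _ _ (yz xs dxs)).
  have -> : (fun t => xs (y t)) = (fun t => `|xs (T t x)|) by exact/funext.
  exact: cvg_trans (cvg_app _ FU) Tx.
have dT : dual_space (xs \o T s).
  have [Tl Tc] := Tlc s s0; split.
    by move=> a u v /=; rewrite Tl (proj1 dxs).
  by move=> u; apply: continuous_comp; [exact: Tc|exact: (proj2 dxs)].
(* The limit of [|xs (T s (y t))|] is computed twice: by weak convergence, and by the semigroup law,
   where the phase drops out of the modulus. *)
have nTs : `|xs (T s (y t))| @[t --> U] --> `|xs (T s x)|.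
  by rewrite -zx; apply: (@cvg_norm R[i] R[i]); exact: yz dT.
have Ts1 : `|xs (T s (y t))| @[t --> U] --> (1 : R[i]).
  have Tst : `|xs (T (s + t) x)| @[t --> +oo] --> (1 : R[i]).
    exact: (cvg_comp (fun t => s + t) _ (cvg_addl_pinfty _ s) Tx).
  apply: cvg_trans (cvg_trans (cvg_app _ FU) Tst).
  apply: near_eq_cvg; apply: FU.
  apply: filterS2 c1 (nbhs_pinfty_ge (real0 R)) => t ct t0.
  have -> : xs (T s (y t)) = c t * xs (T s (T t x)).
    exact: (dual_spaceZ _ _ _ (c t) (T t x) dT).
  by rewrite normrM ct mul1r TD.
exact: (@cvg_unique R[i] (@norm_hausdorff _ _) _ _ _ _ nTs Ts1).
Unshelve. all: by end_near. Qed.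

(** * Characters of the half-line *)

Lemma unit_Re2Im2 (R : realType) (z : R[i]) :
  `|z| = 1 -> complex.Re z ^+ 2 + complex.Im z ^+ 2 = 1.
Proof.
move=> z1; have := add_Re2_Im2 z; rewrite z1 expr1n.
by move=> /(congr1 (@complex.Re R)).
Qed.

Lemma unit_Re_le1 (R : realType) (z : R[i]) : `|z| = 1 -> complex.Re z <= 1.
Proof.
move=> z1; have := normc_ge_Re z; rewrite z1 lecR.
exact/le_trans/ler_norm.
Qed.

(* For a unit complex number [z] with [Re z > 1/2], squaring at least doubles
   the defect [1 - Re z]. *)
Lemma unit_powers_near1 (R : realType) (z : R[i]) : `|z| = 1 ->
  (forall n, 1 / 2 < complex.Re (z ^+ (2 ^ n))) -> z = 1.
Proof.
move=> z1 zn; pose d n := 1 - complex.Re (z ^+ (2 ^ n)).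
(* If [w] is a unit number with real part [a], then [w^2] has real part [2 a^2 - 1] and defect
   [2 (1 - a) (1 + a)]. *)
have dS n : 2 * d n <= d n.+1.
  have wn : `|z ^+ (2 ^ n)| = 1 by rewrite normrX z1 expr1n.
  rewrite /d expnS mulnC exprM [(_ ^+ _) ^+ 2]expr2.
  have := unit_Re2Im2 _ _ wn; have := zn n.
  have := unit_Re_le1 _ _ wn.
  case: (z ^+ _) => a b /= a1 a12 ab; nra.
have d0 : 0 <= d 0.
  by rewrite /d expr1 subr_ge0 unit_Re_le1.
have dn n : n.+1%:R * d 0 <= d n.
  elim: n => [|n IH]; first by rewrite mul1r.
  apply: le_trans (dS n).
  have n0 : 0 <= n%:R * d 0 by rewrite mulr_ge0.
  move: IH; rewrite -!natr1; lra.
have d00 : d 0 = 0.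
  apply/eqP; rewrite eq_le d0 andbT leNgt; apply/negP => dp.
  (* With [n] the integer part of [1 / d 0], this gives [1 < (n + 1) d 0 <= d n < 1/2]. *)
  have := dn (Num.truncn (d 0)^-1).
  have := truncnS_gt (d 0)^-1; rewrite -(ltr_pM2r dp) mulVf ?gt_eqF //.
  move=> /lt_le_trans /[apply]; have := zn (Num.truncn (d 0)^-1).
  by rewrite /d; lra.
have Rz : complex.Re z = 1 by move: d00; rewrite /d expr1; lra.
have := unit_Re2Im2 _ _ z1; rewrite Rz expr1n => /eqP.
rewrite addrC -subr_eq0 addrK expf_eq0 /= => /eqP Iz.
by rewrite [z]complexE Rz Iz mulr0 addr0.
Qed.

Definition cis {R : realType} (t : R) : R[i] := cos t +i* sin t.

Lemma cisD (R : realType) (s t : R) : cis (s + t) = cis s * cis t.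
Proof.
rewrite /cis cosD sinD; apply/eqP; rewrite eq_complex /=.
by apply/andP; split; apply/eqP; ring.
Qed.

Lemma norm_cis (R : realType) (t : R) : `|cis t| = 1.
Proof. by rewrite normc_def /= cos2Dsin2 sqrtr1. Qed.

Lemma cis0 (R : realType) : cis (0 : R) = 1.
Proof. by rewrite /cis cos0 sin0. Qed.

Lemma unitary_character (R : realType) (chi : R -> R[i]) :
  chi 0 = 1 -> (forall t, 0 <= t -> `|chi t| = 1) ->
  (forall s t, 0 <= s -> 0 <= t -> chi (s + t) = chi s * chi t) ->
  chi t @[t --> 0^'+] --> (1 : R[i]) ->
  exists lambda : R, forall t, 0 <= t -> chi t = cis (lambda * t).
Proof.
move=> chi0 chi1 chiD chic.
have [c c0 chi78] : exists2 c : R, 0 < c &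
    forall t, 0 <= t <= c -> 7%:R / 8%:R < complex.Re (chi t).
  have e0 : 0 < (1 / 8)%:C :> R[i] by rewrite ltcR divr_gt0.
  have /cvgrPdist_lt /(_ _ e0) := chic.
  move=> [e /= e_gt0 He]; exists (e / 2); first by rewrite divr_gt0.
  (* The filter [0^'+] omits 0, so [t = 0] is treated apart. *)
  move=> t /andP[]; rewrite le_eqVlt => /predU1P[<- _|t0 te].
    by rewrite chi0 /=; lra.
  have : `|1 - chi t| < (1 / 8)%:C.
    apply: He => //=; rewrite sub0r normrN gtr0_norm //; lra.
  move=> /(le_lt_trans (normc_ge_Re _)); rewrite ltcR ltr_norml.
  by case: (chi t) => a b /= /andP[]; lra.
have := chi78 c; have := unit_Re2Im2 _ _ (chi1 c (ltW c0)).
rewrite lexx ltW //; set a := complex.Re _; set b := complex.Im _.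
move=> ab /(_ isT) a78.
have b1 : -1 <= b <= 1 by apply/andP; split; nra.
(* Since [a > 0], the arcsine is the right angle choice: its cosine is the nonnegative root [a]. *)
pose theta := asin b; pose lambda := theta / c.
have sinth : sin theta = b by rewrite asinK // in_itv.
have costh : cos theta = a.
  rewrite cos_asin // -ab addrK sqrtr_sqr ger0_norm //; lra.
exists lambda.
pose psi t := chi t * cis (- (lambda * t)).
have psi1 t : 0 <= t -> `|psi t| = 1.
  by move=> t0; rewrite normrM chi1 // norm_cis mulr1.
have psiD s t : 0 <= s -> 0 <= t -> psi (s + t) = psi s * psi t.
  by move=> s0 t0; rewrite /psi chiD // mulrDr opprD cisD mulrACA.
have psi0 : psi 0 = 1 by rewrite /psi chi0 mulr0 oppr0 cis0 mulr1.
have psic : psi c = 1.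
  rewrite /psi; have -> : chi c = cis (lambda * c).
    by rewrite /lambda divfK ?gt_eqF // /cis costh sinth /a /b; case: (chi c).
  by rewrite -cisD subrr cis0.
have psinc (n : nat) : psi (n%:R * c) = 1.
  elim: n => [|n IH]; first by rewrite mul0r.
  rewrite -natr1 mulrDl mul1r psiD ?IH ?psic ?mulr1 //; last exact: ltW.
  by rewrite mulr_ge0 // ltW.
have psi_small t : 0 <= t <= c -> 1 / 2 < complex.Re (psi t).
  move=> tc; have /andP[t0 tc'] := tc.
  have cos78 : 7 / 8 < cos (lambda * t).
    have tc1 : 0 <= t / c <= 1 by rewrite divr_ge0 ?ler_pdivrMr ?mul1r // ltW.
    have th : `|theta| <= pi / 2.
      by rewrite ler_norml asin_geNpi2 ?asin_lepi2.
    have pi0 := pi_gt0 R.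
    have -> : lambda * t = theta * (t / c) by rewrite /lambda mulrAC mulrA.
    (* Cosine is even and decreasing on [[0, pi]], and [|lambda * t| <= |theta|]. *)
    apply: lt_le_trans a78 _; rewrite -costh -cos_norm -[leRHS]cos_norm.
    have /andP[s0 s1] := tc1.
    have n0 : 0 <= `|theta| by [].
    rewrite normrM (ger0_norm s0) leNgt ltr_cos ?in_itv /=.
    - by rewrite -leNgt; nra.
    - by apply/andP; split; nra.
    - by apply/andP; split; nra.
  have := chi78 t tc; have := unit_Re2Im2 _ _ (chi1 t t0).
  have := cos2Dsin2 (lambda * t); rewrite /psi /cis cosN sinN.
  move: cos78; case: (chi t) => u v /=; set C := cos _; set S := sin _.
  move=> C78 CS uv u78.
  (* The real part of [psi t] is [u C + v S], and [v S >= - (v^2 + S^2) / 2 > - 15/64]; the bound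
     7/8 thus leaves [34/64 > 1/2]. *)
  have uC : 49 / 64 < u * C by nra.
  have v2 : v ^+ 2 < 15 / 64 by nra.
  have S2 : S ^+ 2 < 15 / 64 by nra.
  have := sqr_ge0 (v + S); nra.
have psi_half t : 0 <= t -> 1 / 2 < complex.Re (psi t).
  move=> t0; pose n := Num.truncn (t / c).
  have tc0 : 0 <= t / c by rewrite divr_ge0 // ltW.
  have /andP[nt tn] := truncn_itv tc0.
  rewrite -/n ler_pdivlMr // in nt; rewrite -/n ltr_pdivrMr // -natr1 mulrDl mul1r in tn.
  have -> : t = n%:R * c + (t - n%:R * c) by rewrite addrC subrK.
  rewrite psiD ?subr_ge0 // ?psinc ?(mul1r (psi _)); last by rewrite mulr_ge0 // ltW.
  by apply: psi_small; rewrite subr_ge0 nt lerBlDl ltW.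
have psiX (n : nat) t : 0 <= t -> psi t ^+ n = psi (n%:R * t).
  move=> t0; elim: n => [|n IH]; first by rewrite mul0r expr0.
  by rewrite exprSr IH -psiD ?mulr_ge0 // -natr1 mulrDl mul1r.
move=> t t0; have /(congr1 (fun z => z * cis (lambda * t))) : psi t = 1.
  apply: unit_powers_near1 (psi1 t t0) _ => n.
  by rewrite psiX //; apply: psi_half; rewrite mulr_ge0.
by rewrite mul1r -mulrA -cisD addNr cis0 mulr1.
Qed.

(** * Differentiation at 0 and the eigenvalue equation *)

Lemma is_derive_right_quotient (R : realType) (f : R -> R) (a : R) :
  is_derive (0 : R) 1 f a -> t^-1 * (f t - f 0) @[t --> 0^'+] --> a.
Proof.
move=> fa; apply: cvg_dnbhs_at_right; rewrite -(@derive_val _ _ _ _ _ _ _ fa).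
have := @ex_derive _ _ _ _ _ _ _ fa; rewrite /derivable /derive.
suff -> : (fun t => t^-1 * (f t - f 0)) =
    (fun h => h^-1 *: ((f \o shift 0) (h *: 1) - f 0)) by [].
by apply/funext => h /=; rewrite addr0 /GRing.scale /= mulr1.
Qed.

Lemma cis_right_quotient (R : realType) (lambda : R) :
  (t%:C)^-1 * (cis (lambda * t) - 1) @[t --> 0^'+] --> (lambda%:C * 'i : R[i]).
Proof.
(* The values 1 and 0 are written as [cos (lambda * 0)] and [sin (lambda * 0)] to give each part the
   form of a difference quotient. *)
have qE (t : R) : (t%:C)^-1 * (cis (lambda * t) - 1) =
    (t^-1 * (cos (lambda * t) - cos (lambda * 0)))
    +i* (t^-1 * (sin (lambda * t) - sin (lambda * 0))).
  rewrite -(fmorphV (real_complex R)) mulr0 cos0 sin0.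
  apply/eqP; rewrite eq_complex /=.
  by apply/andP; split; apply/eqP; ring.
apply: cvg_complex; under eq_fun do rewrite qE /=.
- have : is_derive (0 : R) 1 (fun t => cos (lambda * t)) 0.
    apply: is_derive_eq.
    by change (- sin (lambda * 0) * (lambda * 1) = 0); rewrite mulr0 sin0 oppr0 mul0r.
  by move=> /is_derive_right_quotient; rewrite /= mulr0 mul0r subrr.
- have : is_derive (0 : R) 1 (fun t => sin (lambda * t)) lambda.
    apply: is_derive_eq.
    by change (cos (lambda * 0) * (lambda * 1) = lambda); rewrite mulr0 cos0 mul1r mulr1.
  by move=> /is_derive_right_quotient; rewrite /= mulr1 mul0r addr0.
Qed.

Theorem theorem5 (R : realType) (X : completeNormedModType R[i])
  (x : X) (xs : X -> R[i]) (T : R -> X -> X) :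
  reflexive_space X ->
  `|x| = 1 ->
  exposes xs x ->
  C0_contraction_semigroup T ->
  `|xs (T t x)| @[t --> +oo] --> (1 : R[i]) ->
  exists lambda : R, generator_value T x ((lambda%:C * 'i) *: x).
Proof.
move=> Xrefl x1 xsx TC0 Tx.
have chi1 t : 0 <= t -> `|xs (T t x)| = 1.
  exact: (norm_orbit_functional _ _ _ _ _ _ Xrefl x1 xsx TC0 Tx).
have [Tlc T0 TD Tcont Tle] := TC0; have [dxs _ xsx1 _] := xsx.
have Teig t : 0 <= t -> T t x = xs (T t x) *: x.
  move=> t0; apply: exposes_phase xsx _ (chi1 t t0).
  by rewrite -x1; exact: Tle.
have [lambda chiE] : exists lambda : R,
    forall t, 0 <= t -> xs (T t x) = cis (lambda * t).
  apply: unitary_character chi1 _ _.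
  - by rewrite T0.
  - move=> s t s0 t0; rewrite TD //.
    have [Tl _] := Tlc s s0.
    have Ts0 : T s 0 = 0.
      by have := Tl (-1) 0 0; rewrite scaler0 addr0 scaleN1r addNr.
    have TsZ a : T s (a *: x) = a *: T s x.
      by have := Tl a x 0; rewrite Ts0 !addr0.
    (* Multiplicativity: [T t x] is a multiple of [x], and its scalar passes through [T s] and
       [xs]. *)
    by rewrite [in LHS](Teig t t0) TsZ (dual_spaceZ _ _ _ _ _ dxs) mulrC.
  - rewrite -xsx1; apply: (cvg_comp (T^~ x) xs (Tcont x)).
    exact: (proj2 dxs x).
exists lambda; rewrite /generator_value.
have xcvg : ((t%:C)^-1 * (cis (lambda * t) - 1)) *: x @[t --> 0^'+] --> (lambda%:C * 'i) *: x.
  exact: (@cvgZr_tmp R[i] X R _ _ _ _ x (cis_right_quotient R lambda)).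
apply: cvg_trans xcvg; apply: near_eq_cvg.
near=> t.
have t0 : 0 <= t by apply: ltW; near: t; exact: nbhs_right_gt.
by rewrite -scalerA scalerBl scale1r -(chiE t t0) -Teig.
Unshelve. all: by end_near. Qed.
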